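(* Let $d\in\mathbb{N}$ and suppose that $\mathcal{L} \subseteq \mathbb{R}^{2d}$ is a lattice which satisfies one of the following four conditions: (1) $\mathcal{L}$ is symplectic, i.e. $\mathcal{L}=\alpha S \mathbb{Z}^{2d}$ for some $\alpha>0$ and some $S \in \mathrm{Sp}_{2d}(\mathbb{R})$; (2) $\mathcal{L}$ is rectangular, i.e. $\mathcal{L}=D\mathbb{Z}^{2d}$ for some invertible diagonal matrix $D$; (3) $\mathcal{L}$ is separable, i.e. $\mathcal{L} = \mathcal{A} \times \mathcal{B}$ with $\mathcal{A},\mathcal{B}$ lattices in $\mathbb{R}^d$; (4) $\mathcal{L}=\alpha \mathbb{Z}^d \times \beta \mathbb{Z}^d$ for some $\alpha,\beta \in \mathbb{R} \setminus \{ 0 \}$. Then for every window function $g \in L^2(\mathbb{R}^d)$ there exist $f_1,f_2 \in L^2(\mathbb{R}^d)$ such that $|V_g f_1(z)| = |V_g f_2(z)|$ for all $z \in \mathcal{L}$, and there is no $\nu\in\mathbb{C}$ with $|\nu|=1$ and $f_1=\nu f_2$.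
   Context: For $f,g\in L^2(\mathbb{R}^d)$ the short-time Fourier transform is $V_gf(x,\omega)=\int_{\mathbb{R}^d} f(t)\overline{g(t-x)}e^{-2\pi i \omega\cdot t}\,dt$, $x,\omega\in\mathbb{R}^d$. A lattice in $\mathbb{R}^n$ is a set $M\mathbb{Z}^n$ with $M\in\mathrm{GL}_n(\mathbb{R})$. With $\mathcal{J}=\begin{pmatrix}0&-I_d\\ I_d&0\end{pmatrix}$, $\mathrm{Sp}_{2d}(\mathbb{R})=\{S\in\mathrm{GL}_{2d}(\mathbb{R}): S^T\mathcal{J}S=\mathcal{J}\}$. *)

(* Defs.v *)
From HB Require Import structures.
From mathcomp Require Import all_boot all_order all_algebra.
From mathcomp Require Import all_classical all_reals all_analysis.
From mathcomp Require Import complex.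
Set Implicit Arguments. Unset Strict Implicit. Unset Printing Implicit Defensive.
Import Order.TTheory GRing.Theory Num.Theory.
Local Open Scope classical_set_scope.
Local Open Scope ring_scope.

(* Points of R^n are n-tuples of reals, carrying the canonical product
   (= Borel) sigma-algebra on tuples provided by MathComp-Analysis. *)

(* Lebesgue measure on R^n, defined as the iterated product of the
   1-dimensional Lebesgue measure (sections, as in [product_measure1]). *)
Fixpoint lebRn (R : realType) (n : nat) : set (n.-tuple R) -> \bar R :=
  match n with
  | 0 => fun A => \d_([tuple] : 0.-tuple R) A
  | n'.+1 => fun A =>
      integral (@lebesgue_measure R) [set: R]
        (fun x : R => @lebRn R n' [set t : n'.-tuple R | A [tuple of x :: t]])
  end.

Definition cexpi (R : realType) (theta : R) : R[i] :=
  (cos theta +i* sin theta)%C.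

Definition L2 (R : realType) (n : nat) (f : n.-tuple R -> R[i]) : Prop :=
  [/\ measurable_fun [set: n.-tuple R] (fun t => complex.Re (f t)),
      measurable_fun [set: n.-tuple R] (fun t => complex.Im (f t)) &
      (\int[@lebRn R n]_t (((complex.Re (f t)) ^+ 2 + (complex.Im (f t)) ^+ 2)%:E) < +oo)%E].

Definition cintegral (R : realType) (n : nat) (h : n.-tuple R -> R[i]) : R[i] :=
  (fine (\int[@lebRn R n]_t (complex.Re (h t))%:E) +i*
   fine (\int[@lebRn R n]_t (complex.Im (h t))%:E))%C.

Definition STFT (R : realType) (n : nat) (g f : n.-tuple R -> R[i])
  (x omega : 'cV[R]_n) : R[i] :=
  cintegral (fun t : n.-tuple R =>
    f t * conjc (g [tuple tnth t i - x i 0 | i < n]) *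
    cexpi (- (2 * pi * \sum_(i < n) omega i 0 * tnth t i))).

Definition lattice (R : realType) (n : nat) (M : 'M[R]_n) : set 'cV[R]_n :=
  [set M *m map_mx (fun k : int => k%:~R) k | k in [set: 'cV[int]_n]].

Definition is_lattice (R : realType) (n : nat) (L : set 'cV[R]_n) : Prop :=
  exists M : 'M[R]_n, M \in unitmx /\ L = lattice M.

Definition Jmx (R : realType) (d : nat) : 'M[R]_(d + d) :=
  block_mx 0 (- 1%:M) 1%:M 0.

Definition symplectic (R : realType) (d : nat) (S : 'M[R]_(d + d)) : Prop :=
  S^T *m Jmx R d *m S = Jmx R d.

Definition setXcV (R : realType) (d : nat) (A B : set 'cV[R]_d) : set 'cV[R]_(d + d) :=
  [set z | A (usubmx z) /\ B (dsubmx z)].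

(* Main.v *)
Require Import Defs.
From HB Require Import structures.
From mathcomp Require Import all_boot all_order all_algebra.
From mathcomp Require Import all_classical all_reals all_analysis.
From mathcomp Require Import complex.
From mathcomp Require Import measurable_realfun lra ring.
Import Order.TTheory GRing.Theory Num.Theory.
Local Open Scope classical_set_scope.
Local Open Scope ring_scope.
Set Implicit Arguments. Unset Strict Implicit. Unset Printing Implicit Defensive.

(* The symplectic dual of a lattice L contains some (u, eta) with u != 0, i.e.
   eta.x - omega.u is an integer for every (x, omega) in L. Put phi(t) = g(-t) and
     psi(t) = e^(2 pi i eta.t - pi i eta.u) g(u - t),
   a time-frequency shift of phi. Reflecting t -> x + u - t in the integral
   defining A = V_g phi (resp. B = V_g psi) at (x, omega) in L shows that A and B
   are both equal to e^(-2 pi i omega.x) times their complex conjugates. Hence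
   A conj(B) is real and |A + iB| = |A - iB|, so f1 = phi + i psi and
   f2 = phi - i psi have the same phaseless samples on L. If f1 = nu f2 with
   |nu| = 1, then |phi| and |psi| are proportional with equal L^2 norms, hence
   equal, so that |g| is u-periodic, which forces g = 0 a.e. If g = 0 a.e., every
   V_g f vanishes and any two non-proportional functions do. *)

(** * Lebesgue measure on tuples *)

Section lebRn_measure.
Context {R : realType}.
Local Open Scope ereal_scope.
Implicit Types n : nat.

Let consp n (p : measurableTypeR R * n.-tuple R) : n.+1.-tuple R :=
  [tuple of p.1 :: p.2].

Let measurable_consp n : measurable_fun setT (@consp n).
Proof.
exact: (@measurable_cons _ _ (measurableTypeR R * n.-tuple R)%type R
  (@fst _ _) n (@snd _ _)).
Qed.

Let lebRnS n : @lebRn R n.+1 =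
  pushforward ((@lebesgue_measure R) \x (@lebRn R n)) (@consp n).
Proof.
apply/funext => A /=; rewrite /pushforward /product_measure1.
by apply: eq_integral => x _ /=; rewrite xsectionE.
Qed.

(** [lebRn] is a bare set function, and the next product is known to be a measure only over a
    sigma-finite factor, so the measure axioms and sigma-finiteness travel through one induction. *)
Let lebRn_sigma_finite_measure n :
  exists m : {sigma_finite_measure set (n.-tuple R) -> \bar R},
    @lebRn R n = m.
Proof.
elim: n => [|n [m IH]].
  by exists (\d_([tuple] : 0.-tuple R)); apply/funext.
pose p : {measure set (n.+1.-tuple R) -> \bar R} :=
  measure_function_pushforward__canonical__measure_function_Measure
    ((@lebesgue_measure R) \x m) (@measurable_consp n).
have pE : @lebRn R n.+1 = p by rewrite lebRnS IH.
have sf : sigma_finite setT p.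
  have /sigma_finiteP[F [TF ndF Foo]] := sigma_finiteT (@lebesgue_measure R).
  have /sigma_finiteP[G [TG ndG Goo]] := sigma_finiteT m.
  pose uncons (t : n.+1.-tuple R) : measurableTypeR R * n.-tuple R :=
    (thead t, [tuple of behead t]).
  have munc : measurable_fun [set: n.+1.-tuple R] uncons.
    apply/measurable_fun_pair; last exact: measurable_behead.
    exact: (@measurable_tnth _ R).
  (* Both exhaustions increase, so the single index [maxn k l] catches the head and the tail at
     once. *)
  exists (fun k => uncons @^-1` (F k `*` G k)).
    apply/seteqP; split => // t _.
    have [k _ Fk] : (\bigcup_i F i) (thead t) by rewrite -TF.
    have [l _ Gl] : (\bigcup_i G i) [tuple of behead t] by rewrite -TG.
    exists (maxn k l) => //; split => /=.
    - by move: Fk; exact/subsetPset/ndF/leq_maxl.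
    - by move: Gl; exact/subsetPset/ndG/leq_maxr.
  move=> k; have [mF Fk] := Foo k; have [mG Gk] := Goo k; split.
    rewrite -[X in measurable X]setTI; apply: munc => //.
    exact: measurableX.
  rewrite [p _](_ : _ = (lebesgue_measure \x m) (F k `*` G k)).
    by rewrite product_measure1E// lte_mul_pinfty// ge0_fin_numE.
  congr product_measure1; apply/seteqP; split => -[x t] /=;
    by rewrite /uncons/= theadE (_ : [tuple of _] = t)//; apply/val_inj.
pose q := Measure_isSigmaFinite.Build _ _ _ p sf.
by exists (HB.pack_for {sigma_finite_measure set (n.+1.-tuple R) -> \bar R}
  (Measure.sort p) q).
Qed.

Let lebRn0 n : @lebRn R n set0 = 0.
Proof. by have [m ->] := lebRn_sigma_finite_measure n. Qed.

Let lebRn_ge0 n A : 0 <= @lebRn R n A.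
Proof. by have [m ->] := lebRn_sigma_finite_measure n. Qed.

Let lebRn_sigma_additive n : semi_sigma_additive (@lebRn R n).
Proof.
have [m ->] := lebRn_sigma_finite_measure n.
exact: measure_semi_sigma_additive.
Qed.

HB.instance Definition _ n :=
  isMeasure.Build _ _ _ (@lebRn R n) (lebRn0 n) (@lebRn_ge0 n)
    (@lebRn_sigma_additive n).

Let lebRn_sigma_finite n : sigma_finite setT (@lebRn R n).
Proof. by have [m ->] := lebRn_sigma_finite_measure n; exact: sigma_finiteT. Qed.

HB.instance Definition _ n :=
  Measure_isSigmaFinite.Build _ _ _ (@lebRn R n) (lebRn_sigma_finite n).

End lebRn_measure.

(** * Invariance of Lebesgue measure under point reflections *)

Section lebRn_reflect.
Context {R : realType}.
Local Open Scope ereal_scope.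
Implicit Types n : nat.

(** Negation is the case [c = 0] and translations are composites of two reflections, so this one
    family of changes of variables serves the whole proof. *)
Definition reflect_tuple n (c t : n.-tuple R) : n.-tuple R :=
  [tuple (tnth c i - tnth t i)%R | i < n].

Lemma measurable_reflect_tuple n (c : n.-tuple R) :
  measurable_fun setT (reflect_tuple c).
Proof.
apply/measurable_fun_tnthP => i.
rewrite (_ : _ \o _ = fun t => (tnth c i - tnth t i)%R); last first.
  by apply/funext => t; rewrite /= tnth_mktuple.
apply: measurable_funB; [exact: measurable_cst|exact: measurable_tnth].
Qed.

Lemma reflect_tupleK n (c : n.-tuple R) : involutive (reflect_tuple c).
Proof.
by move=> t; apply: eq_from_tnth => i; rewrite !tnth_mktuple subKr.
Qed.

Lemma reflect_tuple_cons n (c : n.+1.-tuple R) (x : R) (t : n.-tuple R) :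
  reflect_tuple c [tuple of x :: t] =
  [tuple of (thead c - x)%R :: reflect_tuple [tuple of behead c] t].
Proof.
apply: eq_from_tnth => i; rewrite tnth_mktuple.
case: (unliftP ord0 i) => [j|] ->; last by rewrite !tnth0.
by rewrite !tnthS tnth_mktuple tnth_behead -[in RHS]lift0 inord_val.
Qed.

(** Lebesgue measure is the only measure giving each interval ]a, b] its length, and the preimage of
    ]a, b] is [c - b, c - a[, of the same length. *)
Lemma lebesgue_measure_reflect (c : R) (A : set R) : measurable A ->
  pushforward lebesgue_measure
    (fun x : measurableTypeR R => (c - x)%R : measurableTypeR R) A =
  lebesgue_measure A.
Proof.
have mc : measurable_fun [set: measurableTypeR R]
   (fun x : measurableTypeR R => (c - x)%R : measurableTypeR R).
  exact: (@measurable_funB _ _ R setT (cst c) id).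
move=> mA; apply/esym; pose p : {measure set (measurableTypeR R) -> \bar R} :=
  measure_function_pushforward__canonical__measure_function_Measure
    (@lebesgue_measure R) mc.
apply: (@lebesgue_measure_unique R p) => //= _ [[a b]] _ <-.
rewrite /pushforward (_ : _ @^-1` _ = `[(c - b)%R, (c - a)%R[%classic); last first.
  by apply/seteqP; split => x /=; rewrite !in_itv/= => /andP[? ?]; apply/andP;
    split; lra.
rewrite /= !lebesgue_measure_itv/= !lte_fin.
by rewrite ltrD2l ltrN2 -!EFinB; congr (if _ then (_)%:E else _); lra.
Qed.

Lemma ge0_integral_lebesgue_reflect (c : R) (f : measurableTypeR R -> \bar R) :
  measurable_fun setT f -> (forall x, 0 <= f x) ->
  \int[lebesgue_measure]_x f (c - x)%R = \int[lebesgue_measure]_x f x.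
Proof.
move=> mf f0.
have mc : measurable_fun [set: measurableTypeR R]
   (fun x : measurableTypeR R => (c - x)%R : measurableTypeR R).
  exact: (@measurable_funB _ _ R setT (cst c) id).
transitivity (\int[pushforward lebesgue_measure
    (fun x : measurableTypeR R => (c - x)%R : measurableTypeR R)]_x f x).
  by rewrite ge0_integral_pushforward.
by apply: eq_measure_integral => A mA _; exact: lebesgue_measure_reflect.
Qed.

Let measurable_section n (A : set (n.+1.-tuple R)) (x : R) : measurable A ->
  measurable [set t : n.-tuple R | A [tuple of x :: t]].
Proof.
move=> mA; rewrite -[X in measurable X]setTI.
exact: (@measurable_cons _ _ _ R (cst x) n id).
Qed.

(** Induction on the dimension: the tail of each slice is reflected by the induction hypothesis, the
    head by the one-dimensional case. *)
Lemma lebRn_reflect n (c : n.-tuple R) (A : set (n.-tuple R)) : measurable A ->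
  lebRn (reflect_tuple c @^-1` A) = lebRn A.
Proof.
elim: n c A => [|n IH] c A mA.
  by congr lebRn; apply/funext => t/=; rewrite /preimage/= [reflect_tuple _ _]tuple0 [t]tuple0.
rewrite /=.
rewrite (eq_integral (fun x : measurableTypeR R =>
    lebRn [set t : n.-tuple R | A [tuple of (thead c - x)%R :: t]])); last first.
  move=> x _.
  rewrite -[RHS](IH [tuple of behead c]); last exact: measurable_section.
  by congr lebRn; apply/funext => t; rewrite /preimage/= reflect_tuple_cons.
apply: (@ge0_integral_lebesgue_reflect _
  (fun x => lebRn [set t : n.-tuple R | A [tuple of x :: t]])) => //.
pose cns (p : measurableTypeR R * n.-tuple R) := [tuple of p.1 :: p.2].
have mcns : measurable_fun setT cns.
  exact: (@measurable_cons _ _ (measurableTypeR R * n.-tuple R)%type R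
    (@fst _ _) n (@snd _ _)).
have mcA : measurable (cns @^-1` A).
  by rewrite -[X in measurable X]setTI; exact: mcns.
apply: eq_measurable_fun (measurable_fun_xsection (@lebRn R n) mcA) => x _ /=.
by rewrite xsectionE.
Qed.

Lemma ge0_integral_reflect n (c : n.-tuple R) (f : n.-tuple R -> \bar R) :
  measurable_fun setT f -> (forall x, 0 <= f x) ->
  \int[@lebRn R n]_t f (reflect_tuple c t) = \int[@lebRn R n]_t f t.
Proof.
move=> mf f0.
transitivity (\int[pushforward (@lebRn R n) (reflect_tuple c)]_x f x).
  by rewrite ge0_integral_pushforward//; exact: measurable_reflect_tuple.
apply: eq_measure_integral => [|mr A mA]; first exact: measurable_reflect_tuple.
by move=> _; exact: lebRn_reflect.
Qed.

Lemma integral_reflect n (c : n.-tuple R) (f : n.-tuple R -> \bar R) :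
  measurable_fun setT f ->
  \int[@lebRn R n]_t f (reflect_tuple c t) = \int[@lebRn R n]_t f t.
Proof.
move=> mf; rewrite integralE [RHS]integralE.
have mp : measurable_fun setT f^\+ by exact: measurable_funepos.
have mn : measurable_fun setT f^\- by exact: measurable_funeneg.
congr (_ - _).
- rewrite -(ge0_integral_reflect c mp (fun=> funepos_ge0 _ _)).
  by apply: eq_integral => t _; rewrite !funeposE.
- rewrite -(ge0_integral_reflect c mn (fun=> funeneg_ge0 _ _)).
  by apply: eq_integral => t _; rewrite !funenegE.
Qed.

End lebRn_reflect.

(** * Complex-valued integrals *)

(** A squared modulus with values in [R], ready for integration; the norm of [R[i]] takes its values
    in [R[i]] itself. *)
Definition sqnormc (R : realType) (z : R[i]) : R :=
  complex.Re z ^+ 2 + complex.Im z ^+ 2.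

Definition measurable_cfun (R : realType) n (h : n.-tuple R -> R[i]) : Prop :=
  measurable_fun setT (fun t => complex.Re (h t)) /\
  measurable_fun setT (fun t => complex.Im (h t)).

Definition cintegrable (R : realType) n (h : n.-tuple R -> R[i]) : Prop :=
  (@lebRn R n).-integrable setT (fun t => (complex.Re (h t))%:E) /\
  (@lebRn R n).-integrable setT (fun t => (complex.Im (h t))%:E).

(** * Coordinates, moduli and phases of complex numbers *)

Section complex_coordinates.
Context {R : realType}.
Implicit Types z w : R[i].

Lemma ReM z w : complex.Re (z * w) =
  complex.Re z * complex.Re w - complex.Im z * complex.Im w.
Proof. by case: z => a b; case: w. Qed.

Lemma ImM z w : complex.Im (z * w) =
  complex.Re z * complex.Im w + complex.Im z * complex.Re w.
Proof. by case: z => a b; case: w. Qed.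

Lemma ReD z w : complex.Re (z + w) = complex.Re z + complex.Re w.
Proof. by case: z => a b; case: w. Qed.

Lemma ImD z w : complex.Im (z + w) = complex.Im z + complex.Im w.
Proof. by case: z => a b; case: w. Qed.

Lemma ReJ z : complex.Re (conjc z) = complex.Re z.
Proof. by case: z. Qed.

Lemma ImJ z : complex.Im (conjc z) = - complex.Im z.
Proof. by case: z. Qed.

Lemma complexP z w : complex.Re z = complex.Re w ->
  complex.Im z = complex.Im w -> z = w.
Proof. by case: z => a b; case: w => c d /= -> ->. Qed.

Lemma conjcM z w : conjc (z * w) = conjc z * conjc w.
Proof.
by apply: complexP; rewrite ?ReJ ?ImJ ?ReM ?ImM ?ReJ ?ImJ; ring.
Qed.

Lemma sqnormc_ge0 z : 0 <= sqnormc z.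
Proof. by rewrite addr_ge0 ?sqr_ge0. Qed.

Lemma sqnormcM z w : sqnormc (z * w) = sqnormc z * sqnormc w.
Proof. by rewrite /sqnormc ReM ImM; ring. Qed.

Lemma sqnormc_conj z : sqnormc (conjc z) = sqnormc z.
Proof. by rewrite /sqnormc ReJ ImJ sqrrN. Qed.

Lemma sqnormc_eq0 z : sqnormc z = 0 -> z = 0.
Proof.
move/eqP; rewrite paddr_eq0 ?sqr_ge0// !sqrf_eq0 => /andP[/eqP a /eqP b].
exact: complexP.
Qed.

Lemma normr_sqnormc z : `|z| = (Num.sqrt (sqnormc z))%:C%C.
Proof. exact: normc_def. Qed.

Lemma sqnormc_norm1 z : `|z| = 1 -> sqnormc z = 1.
Proof.
rewrite normr_sqnormc => -[/(congr1 (fun r => r ^+ 2))].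
by rewrite sqr_sqrtr ?sqnormc_ge0// expr1n.
Qed.

Lemma cexpiD (a b : R) : cexpi (a + b) = cexpi a * cexpi b.
Proof.
by apply: complexP; rewrite /cexpi ?ReM ?ImM /= ?cosD ?sinD; ring.
Qed.

Lemma conjc_cexpi (a : R) : conjc (cexpi a) = cexpi (- a).
Proof. by rewrite /cexpi /= cosN sinN. Qed.

Lemma cexpi0 : cexpi (0 : R) = 1.
Proof. by rewrite /cexpi cos0 sin0. Qed.

Lemma sqnormc_cexpi (a : R) : sqnormc (cexpi a) = 1.
Proof. exact: cos2Dsin2. Qed.

Lemma cexpi_int (k : int) : cexpi (2 * pi * k%:~R : R) = 1.
Proof.
have nat_case (m : nat) : cexpi (2 * pi * m%:R : R) = 1.
  elim: m => [|m IH]; first by rewrite mulr0 cexpi0.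
  rewrite -(natr1 m) mulrDr cexpiD IH mul1r mulr1 /cexpi.
  by rewrite mulr_natl cos2pi sin2pi.
case: k => m; first exact: nat_case.
rewrite NegzE mulrNz mulrN -conjc_cexpi nat_case.
by apply: complexP => /=; rewrite ?oppr0.
Qed.

End complex_coordinates.

(** * Square-integrable functions and the algebra of the complex integral *)

Section complex_integral.
Context {R : realType} {n : nat}.
Implicit Types (f g h : n.-tuple R -> R[i]) (c : n.-tuple R).
Local Notation mu := (@lebRn R n).

Lemma L2_measurable f : L2 f -> measurable_cfun f.
Proof. by case. Qed.

Lemma measurable_cfunM f g : measurable_cfun f -> measurable_cfun g ->
  measurable_cfun (fun t => f t * g t).
Proof.
move=> [f1 f2] [g1 g2]; split.
- under eq_fun do rewrite ReM.
  by apply: measurable_funB; exact: measurable_funM.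
- under eq_fun do rewrite ImM.
  by apply: measurable_funD; exact: measurable_funM.
Qed.

Lemma measurable_cfunD f g : measurable_cfun f -> measurable_cfun g ->
  measurable_cfun (fun t => f t + g t).
Proof.
move=> [f1 f2] [g1 g2]; split.
- under eq_fun do rewrite ReD.
  exact: measurable_funD.
- under eq_fun do rewrite ImD.
  exact: measurable_funD.
Qed.

Lemma measurable_cfun_conj f : measurable_cfun f ->
  measurable_cfun (fun t => conjc (f t)).
Proof.
move=> [f1 f2]; split.
- by under eq_fun do rewrite ReJ.
- under eq_fun do rewrite ImJ.
  exact: measurable_funN.
Qed.

Lemma measurable_cfun_cst (z : R[i]) : measurable_cfun (fun _ : n.-tuple R => z).
Proof. by split; exact: measurable_cst. Qed.

Lemma measurable_cfun_cexpi (r : n.-tuple R -> R) : measurable_fun setT r ->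
  measurable_cfun (fun t => cexpi (r t)).
Proof.
move=> mr; split => /=; apply: measurableT_comp => //; apply: continuous_measurable_fun.
- exact: continuous_cos.
- exact: continuous_sin.
Qed.

Lemma measurable_cfun_reflect f c : measurable_cfun f ->
  measurable_cfun (fun t => f (reflect_tuple c t)).
Proof.
move=> [f1 f2]; split.
- exact: (measurableT_comp f1 (measurable_reflect_tuple c)).
- exact: (measurableT_comp f2 (measurable_reflect_tuple c)).
Qed.

Lemma measurable_sqnormc f : measurable_cfun f ->
  measurable_fun setT (fun t => sqnormc (f t)).
Proof. by move=> [f1 f2]; apply: measurable_funD; exact: measurable_funX. Qed.

Lemma L2E f : L2 f <-> measurable_cfun f /\
  (\int[mu]_t (sqnormc (f t))%:E < +oo)%E.
Proof. by split => [[? ? ?]|[[? ?] ?]]. Qed.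

Lemma integrable_sqnormc f : L2 f ->
  mu.-integrable setT (fun t => (sqnormc (f t))%:E).
Proof.
move=> /L2E[mf fi]; apply/integrableP; split.
  by apply/measurable_EFinP; exact: measurable_sqnormc.
by under eq_integral do rewrite gee0_abs ?lee_fin ?sqnormc_ge0//.
Qed.

Lemma L2_reflect f c : L2 f -> L2 (fun t => f (reflect_tuple c t)).
Proof.
move=> /L2E[mf fi]; apply/L2E; split; first exact: measurable_cfun_reflect.
rewrite (ge0_integral_reflect c (f := fun t => (sqnormc (f t))%:E))//.
- by apply/measurable_EFinP; exact: measurable_sqnormc.
- by move=> t; rewrite lee_fin sqnormc_ge0.
Qed.

(** The squared norm is scaled by [C]; this covers both unimodular phases and constant factors. *)
Lemma L2Ml f (e : n.-tuple R -> R[i]) (C : R) : measurable_cfun e ->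
  (forall t, sqnormc (e t) = C) -> L2 f -> L2 (fun t => e t * f t).
Proof.
move=> me eC Lf; have /L2E[mf fi] := Lf; apply/L2E; split.
  exact: measurable_cfunM.
under eq_integral do rewrite sqnormcM eC EFinM.
exact: integrable_lty (integrableZl measurableT C (integrable_sqnormc Lf)).
Qed.

(** The pointwise bound is |f + g|^2 <= 2 |f|^2 + 2 |g|^2, whose gap is |f - g|^2. *)
Lemma L2D f g : L2 f -> L2 g -> L2 (fun t => f t + g t).
Proof.
move=> Lf Lg; have /L2E[mf fi] := Lf; have /L2E[mg gi] := Lg.
apply/L2E; split; first exact: measurable_cfunD.
have h1 := integrable_sqnormc Lf; have h2 := integrable_sqnormc Lg.
have hI := integrableD measurableT (integrableD measurableT h1 h2)
  (integrableD measurableT h1 h2).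
apply: (integrable_lty measurableT); apply: (le_integrable measurableT _ _ hI).
  apply/measurable_EFinP.
  exact: (measurable_sqnormc (measurable_cfunD mf mg)).
move=> t _ /=; rewrite lee_fin.
rewrite /sqnormc !ger0_norm ?(addr_ge0, sqr_ge0)//.
rewrite -subr_ge0 [leRHS](_ : _ = (complex.Re (f t) - complex.Re (g t)) ^+ 2 +
    (complex.Im (f t) - complex.Im (g t)) ^+ 2); first by rewrite addr_ge0 ?sqr_ge0.
by rewrite ReD ImD; ring.
Qed.

Lemma cintegrable_L2 f g (e : n.-tuple R -> R[i]) : L2 f -> L2 g ->
  measurable_cfun e -> (forall t, sqnormc (e t) = 1) ->
  cintegrable (fun t => f t * conjc (g t) * e t).
Proof.
move=> Lf Lg me e1; have /L2E[mf fi] := Lf; have /L2E[mg gi] := Lg.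
have [mh1 mh2] : measurable_cfun (fun t => f t * conjc (g t) * e t).
  by do 2 ?apply: measurable_cfunM => //; exact: measurable_cfun_conj.
have hI := integrableD measurableT (integrable_sqnormc Lf) (integrable_sqnormc Lg).
(* Applied with [r] the real and then the imaginary part: r^2 <= |f|^2 |g|^2 <= (|f|^2 +
   |g|^2)^2. *)
have bound t (r s : R) : r ^+ 2 + s ^+ 2 = sqnormc (f t * conjc (g t) * e t) ->
    `|r| <= sqnormc (f t) + sqnormc (g t).
  rewrite !sqnormcM e1 sqnormc_conj mulr1 => rs.
  have a0 := sqnormc_ge0 (f t); have b0 := sqnormc_ge0 (g t).
  have ab0 := addr_ge0 a0 b0.
  rewrite -(@ler_pXn2r _ 2) ?nnegrE// real_normK ?num_real//.
  nra.
split; apply: (le_integrable measurableT _ _ hI) => //;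
  do ?[exact/measurable_EFinP]; move=> t _ /=;
  rewrite lee_fin [leRHS]ger0_norm; do ?[by apply: addr_ge0; exact: sqnormc_ge0].
- exact: (bound t _ (complex.Im (f t * conjc (g t) * e t))).
- by apply: (bound t _ (complex.Re (f t * conjc (g t) * e t))); rewrite addrC.
Qed.

Lemma cintegrableZ (z : R[i]) h : cintegrable h -> cintegrable (fun t => z * h t).
Proof.
move=> [h1 h2]; split.
- under eq_fun do rewrite ReM EFinB !EFinM.
  by apply: integrableB => //; exact: integrableZl.
- under eq_fun do rewrite ImM EFinD !EFinM.
  by apply: integrableD => //; exact: integrableZl.
Qed.

Lemma cintegralD f g : cintegrable f -> cintegrable g ->
  cintegral (fun t => f t + g t) = cintegral f + cintegral g.
Proof.
move=> [f1 f2] [g1 g2]; apply: complexP; rewrite ?ReD ?ImD /=.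
- under eq_integral do rewrite ReD EFinD.
  by rewrite integralD// fineD//; exact: integrable_fin_num.
- under eq_integral do rewrite ImD EFinD.
  by rewrite integralD// fineD//; exact: integrable_fin_num.
Qed.

Lemma cintegralZ (z : R[i]) h : cintegrable h ->
  cintegral (fun t => z * h t) = z * cintegral h.
Proof.
move=> [h1 h2]; apply: complexP; rewrite ?ReM ?ImM /=.
- under eq_integral do rewrite ReM EFinB !EFinM.
  rewrite integralB//; [|exact: integrableZl..].
  rewrite fineB; [|by apply: integrable_fin_num => //; exact: integrableZl..].
  by rewrite !integralZl// !fineM//; exact: integrable_fin_num.
- under eq_integral do rewrite ImM EFinD !EFinM.
  rewrite integralD//; [|exact: integrableZl..].
  rewrite fineD; [|by apply: integrable_fin_num => //; exact: integrableZl..].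
  by rewrite !integralZl// !fineM//; exact: integrable_fin_num.
Qed.

Lemma cintegral_conj h : cintegrable h ->
  cintegral (fun t => conjc (h t)) = conjc (cintegral h).
Proof.
move=> [h1 h2]; apply: complexP; rewrite ?ReJ ?ImJ /=.
- by under eq_integral do rewrite ReJ.
- under eq_integral do rewrite ImJ -mulN1r EFinM.
  by rewrite integralZl// fineM ?mulN1r//; exact: integrable_fin_num.
Qed.

Lemma cintegral_reflect c h : measurable_cfun h ->
  cintegral (fun t => h (reflect_tuple c t)) = cintegral h.
Proof.
move=> [h1 h2]; rewrite /cintegral; congr (fine _ +i* fine _)%C.
- by apply: (integral_reflect c (f := fun t => (complex.Re (h t))%:E));
    exact/measurable_EFinP.
- by apply: (integral_reflect c (f := fun t => (complex.Im (h t))%:E));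
    exact/measurable_EFinP.
Qed.

End complex_integral.

(** * The indicator of the unit cube, a nonzero square-integrable function *)

Section unit_cube.
Context {R : realType}.

Definition unit_cube n : set (n.-tuple R) :=
  [set t | forall i, 0 <= tnth t i <= 1].

Arguments unit_cube : clear implicits.

Lemma measurable_unit_cube n : measurable (unit_cube n).
Proof.
rewrite (_ : unit_cube n =
    \bigcap_(i in [set: 'I_n]) ((fun t : n.-tuple R => tnth t i) @^-1` `[0, 1])).
  apply: fin_bigcap_measurable => // i _.
  by rewrite -[X in measurable X]setTI; apply: measurable_tnth.
by apply/seteqP; split => t /= ht i => [_|]; have := ht i; rewrite /= in_itv//=; apply.
Qed.

(** The slice at [x] is the cube of one dimension less if [x] lies in [0, 1] and is empty otherwise,
    so the slice measures form the indicator of [0, 1]. *)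
Lemma lebRn_unit_cube n : lebRn (unit_cube n) = 1%E.
Proof.
elim: n => [|n IH]; first by rewrite /= diracE mem_set// => -[].
rewrite /= (eq_integral (fun x : measurableTypeR R => (\1_`[0, 1]%classic x)%:E)).
  by rewrite integral_indic//= setIT lebesgue_measure_itv/= lte01 oppr0 adde0.
move=> x _; rewrite indicE.
have cubeE (t : n.-tuple R) :
    unit_cube n.+1 [tuple of (x : R) :: t] <-> 0 <= (x : R) <= 1 /\ unit_cube n t.
  split=> [ht|[hx ht] i].
    by split=> [|i]; [have := ht ord0|have := ht (lift ord0 i)];
      rewrite ?tnth0 ?tnthS.
  by case: (unliftP ord0 i) => [j|] ->; rewrite ?tnth0 ?tnthS.
have [hx|hx] := boolP (0 <= (x : R) <= 1).
  rewrite mem_set/= ?in_itv//= -[RHS]IH; congr lebRn.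
  by apply/seteqP; split => t /=; rewrite cubeE => // -[].
rewrite memNset/= ?in_itv//=; last exact/negP.
rewrite (_ : [set _ | _] = set0) ?measure0//.
by apply/seteqP; split => t //=; rewrite cubeE => -[] /(negP hx).
Qed.

Definition cube_indicator n (t : n.-tuple R) : R[i] := ((\1_(unit_cube n) t)%:C)%C.

Lemma L2_cube_indicator n : L2 (@cube_indicator n).
Proof.
apply/L2E; split.
  split; last exact: (@measurable_cst _ _ _ R setT 0).
  by apply: measurable_indic; exact: measurable_unit_cube.
rewrite (eq_integral (fun t => (\1_(unit_cube n) t)%:E)).
  rewrite integral_indic ?setIT//; last exact: measurable_unit_cube.
  by rewrite [X in (X < _)%E]lebRn_unit_cube ltry.
move=> t _; rewrite /sqnormc /= expr0n addr0 indicE.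
by case: (t \in _); rewrite ?expr1n ?expr0n.
Qed.

(** Serves the case of a zero window: a unimodular multiple of the indicator vanishes nowhere on the
    cube, which has measure 1. *)
Lemma cube_indicator_neq0 n (nu : R[i]) : `|nu| = 1 ->
  ~ (@lebRn R n).-negligible [set t | 0 <> nu * cube_indicator t].
Proof.
move=> nu1; have nu0 : nu != 0 by rewrite -normr_eq0 nu1 oner_eq0.
move=> neg.
have : (@lebRn R n).-negligible (unit_cube n).
  apply: negligibleS neg => t tc /= /esym/eqP.
  rewrite mulf_eq0 (negPf nu0)/= /cube_indicator indicE mem_set//.
  by rewrite oner_eq0.
move=> /(negligibleP _ (@measurable_unit_cube n)) cube0.
have := lebRn_unit_cube n; rewrite [LHS]cube0 => -[] /esym/eqP.
by rewrite oner_eq0.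
Qed.

End unit_cube.

(** * Almost everywhere vanishing and translation invariance *)

Section translation.
Context {R : realType} {n : nat}.
Local Notation mu := (@lebRn R n).

Lemma integral_sqnormc_eq0_ae (f : n.-tuple R -> R[i]) : measurable_cfun f ->
  (\int[mu]_t (sqnormc (f t))%:E = 0)%E -> mu.-negligible [set t | f t <> 0].
Proof.
move=> mf f0.
have ms : measurable_fun setT (fun t => (sqnormc (f t))%:E).
  by apply/measurable_EFinP; exact: measurable_sqnormc.
have /(ae_eq_integral_abs mu measurableT ms) : (\int[mu]_t `|(sqnormc (f t))%:E| = 0)%E.
  by under eq_integral do rewrite gee0_abs ?lee_fin ?sqnormc_ge0//.
apply: negligibleS => t /= ft /(_ I) [] /sqnormc_eq0.
exact: ft.
Qed.

Lemma cintegral_ae0 (h : n.-tuple R -> R[i]) : measurable_cfun h ->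
  mu.-negligible [set t | h t <> 0] -> cintegral h = 0.
Proof.
move=> [h1 h2] hneg; apply: complexP => /=.
- rewrite (ae_eq_integral (cst 0%E)) ?integral0//; first exact/measurable_EFinP.
  by apply: negligibleS hneg => t /= ht ht0; apply: ht => _; rewrite ht0.
- rewrite (ae_eq_integral (cst 0%E)) ?integral0//; first exact/measurable_EFinP.
  by apply: negligibleS hneg => t /= ht ht0; apply: ht => _; rewrite ht0.
Qed.

(* Pairing [H] with a bounded weight that strictly increases along [u]: the
   pairing is unchanged when the weight is shifted by [u], so [H] vanishes a.e. *)
Lemma translation_invariant_integral0 (H : n.-tuple R -> R) (u : n.-tuple R) j :
  tnth u j != 0 -> (forall t, 0 <= H t) ->
  mu.-integrable setT (fun t => (H t)%:E) ->
  mu.-negligible [set t | H (reflect_tuple [tuple 0 | _ < n] t) <>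
                          H (reflect_tuple u t)] ->
  (\int[mu]_t (H t)%:E = 0)%E.
Proof.
move=> uj0 H0 Hint Hneg.
have mH : measurable_fun setT H.
  by apply/measurable_EFinP; exact: measurable_int Hint.
(* Dividing by [tnth u j] makes a shift by [u] raise the argument of [atan] by exactly 1, whatever
   the sign of that coordinate; adding pi / 2 keeps the weight between 0 and pi. *)
pose psi (t : n.-tuple R) : R := atan (tnth t j / tnth u j) + pi / 2.
have psi0 t : 0 <= psi t by rewrite /psi; have := atan_gtNpi2 (tnth t j / tnth u j); lra.
have psi1 t : psi t <= pi by rewrite /psi; have := atan_ltpi2 (tnth t j / tnth u j); lra.
have mpsi : measurable_fun setT psi.
  apply: measurable_funD; last exact: measurable_cst.
  apply: (@measurableT_comp _ _ _ _ _ _ (@atan R)).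
    by apply: continuous_measurable_fun => x; exact: continuous_atan.
  by apply: measurable_funM; [exact: measurable_tnth|exact: measurable_cst].
pose w c t := H t * psi (reflect_tuple c t).
have mw c : measurable_fun setT (w c).
  apply: measurable_funM => //.
  exact: (measurableT_comp mpsi (measurable_reflect_tuple c)).
have w0 c t : 0 <= w c t by rewrite mulr_ge0.
pose z := [tuple 0 | _ < n] : n.-tuple R.
(* The reflection is moved from the weight onto [H], where the almost everywhere equality of the two
   reflected copies applies. *)
have pairE c : (\int[mu]_t (w c t)%:E =
    \int[mu]_t (H (reflect_tuple c t) * psi t)%:E)%E.
  rewrite -(ge0_integral_reflect c (f := fun t => (w c t)%:E)).
  - by apply: eq_integral => t _; rewrite /w reflect_tupleK.
  - exact/measurable_EFinP.
  - by move=> t; rewrite lee_fin.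
have wE : (\int[mu]_t (w z t)%:E = \int[mu]_t (w u t)%:E)%E.
  rewrite !pairE; apply: ae_eq_integral => //.
  - apply/measurable_EFinP; apply: measurable_funM => //.
    exact: (measurableT_comp mH (measurable_reflect_tuple z)).
  - apply/measurable_EFinP; apply: measurable_funM => //.
    exact: (measurableT_comp mH (measurable_reflect_tuple u)).
  - by apply: negligibleS Hneg => t /= ht hE; apply: ht => _; rewrite hE.
have wlt t : psi (reflect_tuple z t) < psi (reflect_tuple u t).
  rewrite /psi !tnth_mktuple ltrD2r; apply: lt_atan.
  by rewrite sub0r mulrBl divff// mulNr; lra.
(* [D] is nonnegative and will have integral 0, hence vanishes almost everywhere; its second factor
   is positive everywhere, so it is [H] that vanishes. *)
pose D t := H t * (psi (reflect_tuple u t) - psi (reflect_tuple z t)).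
have DE t : D t = w u t - w z t by rewrite /D mulrBr.
have D0 t : 0 <= D t by rewrite mulr_ge0// subr_ge0 ltW.
have mD : measurable_fun setT (fun t => (D t)%:E).
  apply/measurable_EFinP; rewrite (_ : D = fun t => w u t - w z t).
    exact: measurable_funB.
  exact/funext.
(* The bound of the weight by pi makes both pairings finite, so the two equal integrals can be
   subtracted. *)
have wint c : mu.-integrable setT (fun t => (w c t)%:E).
  apply: (le_integrable measurableT _ _ (integrableZl measurableT pi Hint)).
    exact/measurable_EFinP.
  move=> t _ /=; rewrite lee_fin !ger0_norm ?mulr_ge0// ?pi_ge0//.
  by rewrite [leRHS]mulrC; apply: ler_wpM2l.
have intD : (\int[mu]_t (D t)%:E = 0)%E.
  rewrite (eq_integral (fun t => (w u t)%:E - (w z t)%:E)%E).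
    by rewrite integralB// wE subee//; exact: integrable_fin_num.
  by move=> t _; rewrite DE EFinB.
have Dneg : mu.-negligible [set t | H t <> 0].
  have /(ae_eq_integral_abs mu measurableT mD) : (\int[mu]_t `|(D t)%:E| = 0)%E.
    by under eq_integral do rewrite gee0_abs ?lee_fin//.
  apply: negligibleS => t /= Ht /(_ I) [] /eqP.
  by rewrite mulf_eq0 subr_eq0 (gt_eqF (wlt t)) orbF => /eqP.
rewrite (ae_eq_integral (cst 0%E)) ?integral0//; first exact/measurable_EFinP.
by apply: negligibleS Dneg => t /= Ht Ht0; apply: Ht => _; rewrite Ht0.
Qed.

End translation.

(** * Time-frequency shifts of the reflected window *)

Section reflected_window.
Context {R : realType} {d : nat}.
Implicit Types (g f : d.-tuple R -> R[i]) (x omega u eta : 'cV[R]_d).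
Implicit Types (t c : d.-tuple R).
Local Notation mu := (@lebRn R d).

Definition tuple_of_cV x : d.-tuple R := [tuple x i 0 | i < d].

Definition dotp (a : 'cV[R]_d) t : R := \sum_(i < d) a i 0 * tnth t i.

Lemma dotp_reflect a c t :
  dotp a (reflect_tuple c t) = dotp a c - dotp a t.
Proof.
rewrite /dotp -sumrB; apply: eq_bigr => i _.
by rewrite tnth_mktuple mulrBr.
Qed.

Lemma dotpD a x u :
  dotp a (tuple_of_cV (x + u)) = dotp a (tuple_of_cV x) + dotp a (tuple_of_cV u).
Proof.
rewrite /dotp -big_split; apply: eq_bigr => i _ /=.
by rewrite !tnth_mktuple mxE mulrDr.
Qed.

Lemma measurable_dotp a : measurable_fun setT (dotp a).
Proof.
apply: (@measurable_sum _ _ R) => i.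
by apply: measurable_funM; [exact: measurable_cst|exact: measurable_tnth].
Qed.

Definition translate x t : d.-tuple R := [tuple tnth t i - x i 0 | i < d].

(** Lets translations inherit the invariance of the integral under reflections. *)
Lemma translateE x t :
  translate x t = reflect_tuple [tuple 0 | _ < d] (reflect_tuple (tuple_of_cV x) t).
Proof.
by apply: eq_from_tnth => i; rewrite !tnth_mktuple sub0r opprB.
Qed.

Lemma L2_translate x g : L2 g -> L2 (fun t => g (translate x t)).
Proof.
move=> Lg; rewrite (_ : (fun t => _) = fun t => g (reflect_tuple
  [tuple 0 | _ < d] (reflect_tuple (tuple_of_cV x) t))).
  apply: (L2_reflect (f := fun t => g (reflect_tuple [tuple 0 | _ < d] t))).
  exact: L2_reflect.
by apply/funext => t; rewrite translateE.
Qed.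

Lemma cintegrable_STFT g f x omega : L2 g -> L2 f ->
  cintegrable (fun t => f t * conjc (g (translate x t)) *
    cexpi (- (2 * pi * dotp omega t))).
Proof.
move=> Lg Lf; apply: cintegrable_L2 => //; first exact: L2_translate.
- apply: measurable_cfun_cexpi; apply: measurable_funN; apply: measurable_funM.
    exact: measurable_cst.
  exact: measurable_dotp.
- by move=> t; exact: sqnormc_cexpi.
Qed.

Lemma STFT_linear g f1 f2 (z : R[i]) x omega : L2 g -> L2 f1 -> L2 f2 ->
  STFT g (fun t => f1 t + z * f2 t) x omega =
  STFT g f1 x omega + z * STFT g f2 x omega.
Proof.
move=> Lg L1 L2'; have h1 := cintegrable_STFT x omega Lg L1.
have h2 := cintegrable_STFT x omega Lg L2'.
rewrite /STFT -(cintegralZ z h2) -(cintegralD h1 (cintegrableZ z h2)).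
by congr cintegral; apply/funext => t; rewrite /translate /dotp; ring.
Qed.

(** A translate of a window of zero norm again has zero norm, so the integrand vanishes almost
    everywhere. *)
Lemma STFT_window0 g f x omega : L2 g -> L2 f ->
  (\int[mu]_t (sqnormc (g t))%:E = 0)%E -> STFT g f x omega = 0.
Proof.
move=> Lg Lf g0; have Lgx := L2_translate x Lg.
have Gx0 : (\int[mu]_t (sqnormc (g (translate x t)))%:E = 0)%E.
  have ms h : L2 h -> measurable_fun setT (fun t => (sqnormc (h t))%:E).
    by move=> /L2_measurable mh; apply/measurable_EFinP; exact: measurable_sqnormc.
  rewrite -g0 -(ge0_integral_reflect [tuple 0 | _ < d] (ms _ Lg)).
    rewrite -[RHS](ge0_integral_reflect (tuple_of_cV x)
      (ms _ (L2_reflect [tuple 0 | _ < d] Lg))).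
      by apply: eq_integral => t _; rewrite translateE.
    by move=> t; rewrite lee_fin sqnormc_ge0.
  by move=> t; rewrite lee_fin sqnormc_ge0.
apply: cintegral_ae0.
  have [/measurable_int/measurable_EFinP m1 /measurable_int/measurable_EFinP m2] :=
    cintegrable_STFT x omega Lg Lf.
  by split.
have := integral_sqnormc_eq0_ae (L2_measurable Lgx) Gx0.
apply: negligibleS => t /= ht gt0; apply: ht.
rewrite -/(translate x t) gt0 (_ : conjc 0 = 0); first by rewrite mulr0 mul0r.
by apply: complexP => /=; rewrite ?oppr0.
Qed.

(** The case [u = eta = 0] is g(-t). The constant phase - pi eta.u is chosen so that eta.u drops out
    of the reflection identity for the transform. *)
Definition reflected_atom g u eta t : R[i] :=
  cexpi (2 * pi * dotp eta t - pi * dotp eta (tuple_of_cV u)) *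
  g (reflect_tuple (tuple_of_cV u) t).

Lemma L2_reflected_atom g u eta : L2 g -> L2 (reflected_atom g u eta).
Proof.
move=> Lg; apply: (@L2Ml _ _ (fun t => g (reflect_tuple (tuple_of_cV u) t)) _ 1).
- apply: measurable_cfun_cexpi; apply: measurable_funB; last exact: measurable_cst.
  by apply: measurable_funM; [exact: measurable_cst|exact: measurable_dotp].
- by move=> t; exact: sqnormc_cexpi.
- exact: L2_reflect.
Qed.

(* The substitution [t -> x + u - t] turns the integrand into its conjugate,
   up to a unimodular constant. *)
Lemma STFT_reflected_atom g u eta x omega : L2 g ->
  STFT g (reflected_atom g u eta) x omega =
  cexpi (2 * pi * (dotp eta (tuple_of_cV x) - dotp omega (tuple_of_cV x) -
                   dotp omega (tuple_of_cV u))) *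
  conjc (STFT g (reflected_atom g u eta) x omega).
Proof.
move=> Lg; set P := cexpi _.
pose h t := reflected_atom g u eta t * conjc (g (translate x t)) *
  cexpi (- (2 * pi * dotp omega t)).
have hint : cintegrable h by apply: cintegrable_STFT => //; exact: L2_reflected_atom.
have mh : measurable_cfun h.
  by case: hint => /measurable_int/measurable_EFinP m1
    /measurable_int/measurable_EFinP m2; split.
have hconj : cintegrable (fun t => conjc (h t)).
  case: hint => h1 h2; split; first by under eq_fun do rewrite ReJ.
  under eq_fun do rewrite ImJ EFinN.
  exact: integrableN.
rewrite -[LHS]/(cintegral h) -[in RHS]/(cintegral h).
rewrite -(cintegral_conj hint) -(cintegralZ P hconj).
rewrite -[LHS](cintegral_reflect (tuple_of_cV (x + u)) mh).
congr cintegral; apply/funext => t; set c := tuple_of_cV (x + u).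
(* The reflection exchanges the arguments of the two factors [g], one of which is conjugated; this
   is what produces the conjugate integrand. *)
have E1 : reflect_tuple (tuple_of_cV u) (reflect_tuple c t) = translate x t.
  by apply: eq_from_tnth => i; rewrite !tnth_mktuple !mxE; ring.
have E2 : translate x (reflect_tuple c t) = reflect_tuple (tuple_of_cV u) t.
  by apply: eq_from_tnth => i; rewrite !tnth_mktuple !mxE; ring.
rewrite /h /reflected_atom E1 E2 !conjcM !conjc_cexpi.
rewrite (_ : conjc (conjc _) = g (translate x t)); last first.
  by apply: complexP; rewrite !(ReJ, ImJ) ?opprK.
set e1 := cexpi _; set e2 := cexpi (- (2 * _ * dotp omega (reflect_tuple _ _))).
set e3 := cexpi (- (_ - _)); set e4 := cexpi (- - _).
(* The term 2 pi eta.u coming from [c] cancels against the two constants pi eta.u, one in [e1] and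
   one in [e3]. *)
have eE : e1 * e2 = P * (e3 * e4).
  rewrite /e1 /e2 /e3 /e4 /P -!cexpiD; congr cexpi.
  by rewrite !dotp_reflect !dotpD; ring.
transitivity (e1 * e2 * (g (translate x t) *
    conjc (g (reflect_tuple (tuple_of_cV u) t)))); first by ring.
by rewrite eE; ring.
Qed.

End reflected_window.

(* [A conj B] is real, because [A] and [B] both equal [p] times their conjugate. *)
Lemma sqnormc_symmetric (R : realType) (p A B : R[i]) : sqnormc p = 1 ->
  A = p * conjc A -> B = p * conjc B ->
  sqnormc (A + (0 +i* 1)%C * B) = sqnormc (A + (0 +i* -1)%C * B).
Proof.
case: p => c s; case: A => a1 a2; case: B => b1 b2.
rewrite /sqnormc /= => cs [A1 A2] [B1 B2].
(* This is Im(A conj B). Substituting both symmetries turns A conj B into |p|^2 times its conjugate,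
   so its imaginary part equals its own opposite. *)
have K : a2 * b1 - a1 * b2 = 0.
  have : a2 * b1 - a1 * b2 = - ((c ^+ 2 + s ^+ 2) * (a2 * b1 - a1 * b2)).
    transitivity ((c * - a2 + s * a1) * (c * b1 - s * - b2) -
                  (c * a1 - s * - a2) * (c * - b2 + s * b1)); last by ring.
    by rewrite -A1 -A2 -B1 -B2.
  by rewrite cs; lra.
(* Polarization: |A + iB|^2 - |A - iB|^2 = 4 Im(A conj B). *)
apply/eqP; rewrite -subr_eq0 (_ : _ - _ = 4 * (a2 * b1 - a1 * b2)).
  by rewrite K mulr0.
ring.
Qed.

Lemma reflected_atoms_not_proportional (R : realType) d (g : d.-tuple R -> R[i])
    (u eta : 'cV[R]_d) j (nu : R[i]) :
  L2 g -> (\int[@lebRn R d]_t (sqnormc (g t))%:E != 0)%E -> u j 0 != 0 ->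
  `|nu| = 1 ->
  ~ (@lebRn R d).-negligible [set t |
      reflected_atom g 0 0 t + (0 +i* 1)%C * reflected_atom g u eta t <>
      nu * (reflected_atom g 0 0 t + (0 +i* -1)%C * reflected_atom g u eta t)].
Proof.
move=> Lg g0 uj0 nu1 neg.
pose H t := sqnormc (g t).
pose z := [tuple 0 | _ < d] : d.-tuple R.
have zE : tuple_of_cV (0 : 'cV[R]_d) = z.
  by apply: eq_from_tnth => i; rewrite !tnth_mktuple mxE.
have atomE v xi t :
    sqnormc (reflected_atom g v xi t) = H (reflect_tuple (tuple_of_cV v) t).
  by rewrite sqnormcM sqnormc_cexpi mul1r.
(* Proportionality reads (1 - nu) phi = -i (1 + nu) psi; [a] and [b] are the squared moduli of the
   coefficients, and the parallelogram law gives their sum. *)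
pose a := sqnormc (1 - nu); pose b := sqnormc (1 + nu).
have ab : a + b = 4.
  have := sqnormc_norm1 nu1; rewrite /a /b /sqnormc.
  by case: (nu) => p q /= pq; lra.
have pw : (@lebRn R d).-negligible
    [set t | a * H (reflect_tuple z t) <> b * H (reflect_tuple (tuple_of_cV u) t)].
  apply: negligibleS neg => t /= ht fE; apply: ht.
  rewrite -zE -(atomE 0 0) -(atomE u eta) -!sqnormcM.
  set A := reflected_atom g 0 0 t in fE *; set B := reflected_atom g u eta t in fE *.
  have -> : (1 - nu) * A = (0 +i* -1)%C * ((1 + nu) * B).
    move: fE; case: (nu) => p q; case: A => a1 a2; case: B => b1 b2 [h1 h2].
    by apply: complexP; rewrite /=; move: h1 h2; lra.
  by rewrite sqnormcM {1}/sqnormc /= expr0n add0r sqrrN expr1n mul1r.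
have Hint := integrable_sqnormc Lg.
have H0 t : 0 <= H t := sqnormc_ge0 _.
have mH : measurable_fun setT (fun t => (H t)%:E) := measurable_int _ Hint.
have mHr c : measurable_fun setT (fun t => (H (reflect_tuple c t))%:E).
  exact: (measurableT_comp mH (measurable_reflect_tuple c)).
have HrE c : (\int[@lebRn R d]_t (H (reflect_tuple c t))%:E =
    \int[@lebRn R d]_t (H t)%:E)%E.
  by rewrite (ge0_integral_reflect c mH)// => t; rewrite lee_fin.
(* Integrating [pw]: both reflected copies of [H] have the integral of [H], which is finite and
   nonzero, and this forces [a = b]. *)
have aIb : (a%:E * \int[@lebRn R d]_t (H t)%:E =
            b%:E * \int[@lebRn R d]_t (H t)%:E)%E.
  rewrite -[in LHS](HrE z) -[in RHS](HrE (tuple_of_cV u)).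
  rewrite -!ge0_integralZl_EFin ?sqnormc_ge0//;
    do ?by move=> t _; rewrite lee_fin.
  apply: ae_eq_integral => //.
  - exact: measurable_funeM.
  - exact: measurable_funeM.
  - apply: negligibleS pw => t /= ht abt; apply: ht => _.
    by rewrite -!EFinM abt.
have Ifin : (\int[@lebRn R d]_t (H t)%:E)%E \is a fin_num.
  exact: integrable_fin_num.
have aEb : a = b.
  move: aIb g0; rewrite -(fineK Ifin) -!EFinM eqe => -[/eqP].
  by rewrite -subr_eq0 -mulrBl mulf_eq0 subr_eq0 => /orP[/eqP//|/eqP->]; rewrite eqxx.
(* The common value is 2, so it cancels from [pw] and leaves the periodicity of [H]. *)
have a0 : a != 0 by apply/eqP; move: ab aEb; lra.
have : (\int[@lebRn R d]_t (H t)%:E = 0)%E.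
  apply: (@translation_invariant_integral0 R d H (tuple_of_cV u) j) => //.
    by rewrite tnth_mktuple.
  apply: negligibleS pw => t /= ht; rewrite -aEb => /(mulfI a0).
  exact: ht.
by move/eqP; apply/negP.
Qed.

(* A vector of the symplectic dual of the lattice: a row [w] of [M^-1], read as
   [w = (eta, -u)], has [u != 0] for a suitable row. *)
Lemma symplectic_dual_vector (R : realType) d (M : 'M[R]_(d + d)) :
  (0 < d)%N -> M \in unitmx ->
  exists (u eta : 'cV[R]_d) (j : 'I_d), u j 0 != 0 /\
    forall z, lattice M z -> exists k : int,
      \sum_i eta i 0 * usubmx z i 0 - \sum_i dsubmx z i 0 * u i 0 = k%:~R.
Proof.
move=> hd uM; pose j := Ordinal hd.
have [i ij0] : exists i, invmx M i (rshift d j) != 0.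
  (* If this column of the inverse were zero, the diagonal entry of M M^-1 at [rshift d j] would be
     0 instead of 1. *)
  apply/existsP; apply: contraT; rewrite negb_exists => /forallP w0.
  have := mulmxV uM => /matrixP /(_ (rshift d j) (rshift d j)).
  rewrite !mxE eqxx big1 => [/eqP|k _]; first by rewrite eq_sym oner_eq0.
  by move: (w0 k); rewrite negbK => /eqP ->; rewrite mulr0.
exists (\col_k - invmx M i (rshift d k)), (\col_k invmx M i (lshift d k)), j.
split; first by rewrite mxE oppr_eq0.
move=> _ [k _ <-]; exists (k i 0).
(* Row [i] of the inverse applied to z = M k returns the integer [k i 0]; with the sign chosen in
   [u], that product is eta.x - omega.u. *)
have := mulKmx uM (map_mx (fun k : int => k%:~R) k) => /matrixP /(_ i 0).
rewrite !mxE big_split_ord /= => <-; congr (_ + _).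
  by apply: eq_bigr => l _; rewrite !mxE.
by rewrite -sumrN; apply: eq_bigr => l _; rewrite !mxE; ring.
Qed.

Theorem theorem1p2 (R : realType) (d : nat) (hd : (0 < d)%N)
  (L : set 'cV[R]_(d + d)) (HL : is_lattice L)
  (Hcond :
     (exists (alpha : R) (S : 'M[R]_(d + d)),
         0 < alpha /\ symplectic S /\ L = lattice (alpha *: S))
  \/ (exists D : 'M[R]_(d + d),
         is_diag_mx D /\ D \in unitmx /\ L = lattice D)
  \/ (exists A B : set 'cV[R]_d,
         is_lattice A /\ is_lattice B /\ L = setXcV A B)
  \/ (exists alpha beta : R,
         alpha != 0 /\ beta != 0 /\
         L = setXcV (lattice (alpha%:M : 'M[R]_d)) (lattice (beta%:M : 'M[R]_d))))
  (g : d.-tuple R -> R[i]) (Hg : L2 g) :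
  exists f1 f2 : d.-tuple R -> R[i],
    [/\ L2 f1, L2 f2,
        (forall z, L z ->
           `|STFT g f1 (usubmx z) (dsubmx z)| = `|STFT g f2 (usubmx z) (dsubmx z)|) &
        ~ (exists nu : R[i], `|nu| = 1 /\
             (@lebRn R d).-negligible [set t | f1 t <> nu * f2 t])].
Proof.
(* For a window of zero norm all samples vanish, and 0 together with the cube indicator is a valid
   pair. *)
have [g0|g0] := eqVneq (\int[@lebRn R d]_t (sqnormc (g t))%:E)%E 0%E.
  have L0 : L2 (fun _ : d.-tuple R => 0 : R[i]).
    apply/L2E; split; first exact: measurable_cfun_cst.
    by rewrite /sqnormc /= expr0n addr0 integral0 ltry.
  have Lc := @L2_cube_indicator R d.
  exists (fun=> 0), (@cube_indicator R d); split => //.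
    by move=> z _; rewrite !STFT_window0.
  by move=> [nu [nu1]]; exact: cube_indicator_neq0.
have [M [uM LE]] := HL.
have [u [eta [j [uj0 dual]]]] := symplectic_dual_vector hd uM.
have L0 := L2_reflected_atom 0 0 Hg; have Lu := L2_reflected_atom u eta Hg.
have LZ (w : R[i]) : L2 (fun t => w * reflected_atom g u eta t).
  by apply: (@L2Ml _ _ _ (fun=> w) (sqnormc w)) => //; exact: measurable_cfun_cst.
exists (fun t => reflected_atom g 0 0 t + (0 +i* 1)%C * reflected_atom g u eta t).
exists (fun t => reflected_atom g 0 0 t + (0 +i* -1)%C * reflected_atom g u eta t).
split.
- exact: L2D.
- exact: L2D.
- move=> z; rewrite LE => /dual[k kE]; rewrite !STFT_linear// !normr_sqnormc.
  set x := usubmx z in kE *; set omega := dsubmx z in kE *.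
  have dot0l t : dotp 0 t = 0 :> R.
    by rewrite /dotp big1// => i _; rewrite mxE mul0r.
  have dot0r (a : 'cV[R]_d) : dotp a (tuple_of_cV 0) = 0.
    by rewrite /dotp big1// => i _; rewrite tnth_mktuple mxE mulr0.
  have dotE (a v : 'cV[R]_d) : dotp a (tuple_of_cV v) = \sum_i a i 0 * v i 0.
    by apply: eq_bigr => i _; rewrite tnth_mktuple.
  congr ((Num.sqrt _)%:C)%C.
  (* The common factor e^(-2 pi i omega.x) is the one that [STFT_reflected_atom] gives at
     [u = eta = 0]. *)
  apply: (@sqnormc_symmetric _ (cexpi (2 * pi * - dotp omega (tuple_of_cV x)))).
  + exact: sqnormc_cexpi.
  + rewrite [LHS]STFT_reflected_atom//; congr (cexpi (_ * _) * _).
    by rewrite dot0l dot0r; ring.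
  + rewrite [LHS]STFT_reflected_atom//; congr (_ * _).
    (* The phase of the shifted atom exceeds the common one by 2 pi (eta.x - omega.u) = 2 pi k,
       which [cexpi] does not see. *)
    rewrite -[RHS]mulr1 -(cexpi_int k) -cexpiD -kE !dotE; congr cexpi.
    by ring.
- move=> [nu [nu1]].
  exact: (reflected_atoms_not_proportional Hg g0 uj0 nu1).
Qed.
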